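(* Let $T=(V_T,E_T)$ be a tree and let $(\lambda,S_T)$ be a burning of $T$. Then there is a natural structure of a directed graph on the graph $T$, induced by $\lambda$, such that $\lambda$ is a digraph map (from $T$ with this structure to the path graph $P_{\mathbf T}$ with its natural digraph structure, where $\mathbf T$ is the end time of the burning).
   Context: All graphs are finite, simple and undirected, with non-empty vertex set. A tree is a connected graph without circuits. $d_G$ is graph distance ($\infty$ if there is no path). For a vertex $v$ of a graph $G$ and an integer $r\ge 0$, $N_r(v)$ is the induced subgraph of $G$ on $\{w : d_G(v,w)\le r\}$. Burnings: let $S_G=(v_1,\dots,v_n)$, $n\ge 1$, be a non-empty ordered set of vertices of a graph $G$. For $1\le j\le n$ let $\mathcal N_j$ be the induced subgraph of $G$ whose vertex set is the union of the vertex sets of $N_{j-i}(v_i)$, $1\le i\le j$; for $2\le j\le n+1$ let $U_j$ be the induced subgraph whose vertex set is the union of the vertex sets of $N_{j-i}(v_i)$, $1\le i\le j-1$. $S_G$ is a burning sequence if $v_j\notin U_j$ for $2\le j\le n$ and $U_{n+1}=G$. Put $\mathcal N_{n+1}=U_{n+1}=G$ and, for each vertex $v$, $\lambda(v)=\min\{i : v\in\mathcal N_i\}$. The pair $(\lambda,S_G)$ is called a burning of $G$. It is known that $\lambda$ maps the vertex set of $G$ onto $\{1,\dots,\mathbf T\}$ with $\mathbf T=n$ or $\mathbf T=n+1$; the number $\mathbf T$ is called the end time of the burning, and $\lambda$ is regarded as a map $G\to P_{\mathbf T}$, where the path graph $P_m$ has vertices $1,\dots,m$ and edges $\{i,i+1\}$,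 $1\le i\le m-1$. Digraphs: a digraph (directed graph) consists of a set of vertices and a set of ordered pairs of distinct vertices (ordered edges). A structure of a digraph on a graph is given by equipping each edge $\{v,w\}$ with an order (a direction). A digraph map $f\colon G\to H$ is a map of vertices such that for every ordered edge $(v,w)$ of $G$ either $(f(v),f(w))$ is an ordered edge of $H$ or $f(v)=f(w)$. The path graph $P_m$ has the natural digraph structure with ordered edges $(i,i+1)$, $1\le i\le m-1$. The words ''natural'' and ''induced by $\lambda$'' in the claim are used informally. *)

(* Defs.v *)
From mathcomp Require Import all_boot.

Set Implicit Arguments.
Unset Strict Implicit.
Unset Printing Implicit Defensive.

Record graph := Graph {
  vertex :> finType;
  edge : rel vertex;
  edge_sym : symmetric edge;
  edge_irr : irreflexive edge;
  vertex_nonempty : 0 < #|vertex| }.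

Section Distance.
Variable G : graph.
Implicit Types v w : G.

Definition walk_of_length (k : nat) v w : bool :=
  [exists p : k.-tuple G, path (@edge G) v p && (last v p == w)].

Lemma connect_walk v w :
  connect (@edge G) v w -> exists k, walk_of_length k v w.
Proof.
case/connectP => p e_p ->; exists (size p).
by apply/existsP; exists (in_tuple p); rewrite e_p eqxx.
Qed.

(* The value None stands for an infinite distance. *)
Definition dist v w : option nat :=
  match boolP (connect (@edge G) v w) with
  | AltTrue vw => Some (ex_minn (connect_walk vw))
  | AltFalse _ => None
  end.

(* Induced subgraphs are represented by their vertex sets; this one is N_r(v). *)
Definition ball (r : nat) v : {set G} :=
  [set w | if dist v w is Some d then d <= r else false].

End Distance.

Definition connected (G : graph) : Prop :=
  forall v w : G, connect (@edge G) v w.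

(* A cycle in the sense of path.v may go back and forth along a single edge
   (size 2); circuits have at least three vertices. *)
Definition circuit (G : graph) (c : seq G) : Prop :=
  2 < size c /\ ucycle (@edge G) c.

Definition tree (G : graph) : Prop :=
  connected G /\ (forall c : seq G, ~ circuit c).

(* The sequence (v_1, ..., v_n) is a tuple whose indices start at 0, so that
   v_i is tnth S (i - 1); the times j start at 1. *)
Section Burning.
Variables (G : graph) (n : nat) (S : n.-tuple G).

(* The set U_j, for 2 <= j <= n + 1. *)
Definition spread (j : nat) : {set G} :=
  \bigcup_(i < n | i.+1 < j) ball (j - i.+1) (tnth S i).

(* The set N_j: the balls around v_1, ..., v_j for 1 <= j <= n, and the whole
   graph for j = n + 1. *)
Definition burned (j : nat) : {set G} :=
  if j <= n then \bigcup_(i < n | i.+1 <= j) ball (j - i.+1) (tnth S i)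
  else [set: G].

Definition burning_sequence : Prop :=
  [/\ 0 < n,
      uniq S,
      (forall i : 'I_n, 2 <= i.+1 -> tnth S i \notin spread i.+1) &
      spread n.+1 = [set: G]].

Lemma ex_burned (v : G) : exists i, (0 < i) && (v \in burned i).
Proof. by exists n.+1; rewrite /burned ltnn inE. Qed.

Definition lambda (v : G) : nat := ex_minn (ex_burned v).

(* The maximum of lambda, i.e. the number m such that lambda is onto
   {1, ..., m} when S is a burning sequence. *)
Definition end_time : nat := \max_(v : G) lambda v.

Lemma lambda_range (v : G) : 1 <= lambda v <= end_time.
Proof.
rewrite /end_time (leq_bigmax v) andbT /lambda.
by case: ex_minnP => m /andP[].
Qed.

End Burning.

Record digraph := Digraph {
  dvertex :> Type;
  arc : rel dvertex;
  arc_irr : irreflexive arc }.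

Definition digraph_map (D E : digraph) (f : D -> E) : Prop :=
  forall v w : D, arc v w -> arc (f v) (f w) \/ f v = f w.

Definition path_arc (m : nat) : rel {i : nat | 1 <= i <= m} :=
  fun i j => val j == (val i).+1.

Lemma path_arc_irr m : irreflexive (@path_arc m).
Proof. by move=> i; rewrite /path_arc ltn_eqF. Qed.

Definition path_digraph (m : nat) : digraph := Digraph (@path_arc_irr m).

(* Each edge {v, w} is ordered either as (v, w) or as (w, v), not both. *)
Record digraph_structure (G : graph) := DigraphStructure {
  dir : rel G;
  dir_edge : forall v w, dir v w -> edge v w;
  edge_dir : forall v w, edge v w -> dir v w (+) dir w v }.

Lemma dir_irr (G : graph) (D : digraph_structure G) : irreflexive (dir D).
Proof.
by move=> v; apply/negP => /(dir_edge (d := D)); rewrite edge_irr.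
Qed.

Definition directed (G : graph) (D : digraph_structure G) : digraph :=
  Digraph (dir_irr D).

(* Edges go from the earlier to the later burned end; edges whose ends are
   burned at the same time carry no preferred direction. *)
Definition induced_by (G : graph) (f : G -> nat) (D : digraph_structure G) :
    Prop :=
  forall v w : G, edge v w -> f v < f w -> dir D v w.

Definition burning_map (G : graph) (n : nat) (S : n.-tuple G) (v : G) :
    path_digraph (end_time S) :=
  exist _ (lambda S v) (lambda_range S v).

(* Main.v *)
Require Import Defs.
From mathcomp Require Import all_boot.

Set Implicit Arguments.
Unset Strict Implicit.
Unset Printing Implicit Defensive.

(** Fire spreads by one edge per time step, so once [v] is burned each of its
    neighbours is burned at the next step at the latest: the burning time
    [lambda] changes by at most one along an edge ([lambda_edge]).  Direct every
    edge from its earlier to its later burned end.  An edge whose ends have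
    different times then goes from time [i] to time [i + 1], which is an arc of
    the path; an edge whose ends have the same time collapses to a vertex under
    [lambda], which a digraph map allows for either direction, so its direction
    can be fixed by any tie-breaking rule ([level_structure] uses the
    enumeration of the vertices).

    The bound on [lambda] follows from the triangle inequality for balls
    ([ball_edge]), except for the last time [n + 1], by which the whole graph
    is burned by definition. *)

(** Trades the distance, defined as a minimum over walks, for a single walk,
    which can be extended by an edge. *)
Lemma ballP (G : graph) (r : nat) (v w : G) :
  reflect (exists p, [/\ path (@edge G) v p, last v p = w & size p <= r])
          (w \in ball r v).
Proof.
rewrite inE /dist; case: {-}_ / boolP => [vw | not_vw].
  case: ex_minnP => d d_walk d_min.
  apply: (iffP idP) => [le_dr | [q [e_q last_q]]].
    case/existsP: d_walk => p /andP[e_p /eqP last_p].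
    by exists p; rewrite size_tuple.
  apply/leq_trans/d_min/existsP.
  by exists (in_tuple q); rewrite e_q last_q eqxx.
apply: ReflectF => -[p [e_p last_p _]].
by case/negP: not_vw; apply/connectP; exists p.
Qed.

Lemma ball_edge (G : graph) (r : nat) (u v w : G) :
  edge v w -> v \in ball r u -> w \in ball r.+1 u.
Proof.
move=> vw /ballP[p [e_p last_p le_pr]]; apply/ballP.
by exists (rcons p w); rewrite rcons_path e_p last_p vw last_rcons size_rcons.
Qed.

Section BurningTime.
Variables (G : graph) (n : nat) (S : n.-tuple G).

Lemma burned_edge (j : nat) (v w : G) :
  edge v w -> v \in burned S j -> w \in burned S j.+1.
Proof.
move=> vw; rewrite /burned; case: (ltnP j n) => [lt_jn | _]; last by rewrite inE.
rewrite ltnW // => /bigcupP[i le_ij v_i].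
by apply/bigcupP; exists i; [exact: leqW | rewrite subSn //; exact: ball_edge v_i].
Qed.

Lemma lambda_edge (v w : G) : edge v w -> lambda S w <= (lambda S v).+1.
Proof.
move=> vw; rewrite /lambda; case: ex_minnP => l _ l_min.
by case: ex_minnP => k /andP[_ v_k] _; apply: l_min; exact: burned_edge v_k.
Qed.

End BurningTime.

Section LevelStructure.
Variables (G : graph) (f : G -> nat).

(** The enumeration ranks break ties between ends at the same level, so that
    exactly one of the two directions is chosen for every edge. *)
Definition level_dir : rel G := fun v w =>
  edge v w &&
  ((f v < f w) || (f v == f w) && (enum_rank v < enum_rank w)).

Lemma level_dir_edge v w : level_dir v w -> edge v w.
Proof. by case/andP. Qed.

Lemma edge_level_dir v w : edge v w -> level_dir v w (+) level_dir w v.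
Proof.
move=> vw; rewrite /level_dir (edge_sym w v) vw /=.
case: (ltngtP (f v) (f w)) => //= _.
case: ltngtP => // /val_inj/enum_rank_inj eq_vw.
by rewrite eq_vw edge_irr in vw.
Qed.

Definition level_structure : digraph_structure G :=
  DigraphStructure level_dir_edge edge_level_dir.

Lemma level_structure_induced : induced_by f level_structure.
Proof. by move=> v w vw lt_f; rewrite /= /level_dir vw lt_f. Qed.

Lemma level_dir_le v w : level_dir v w -> f v <= f w.
Proof. by case/andP=> _ /orP[/ltnW // | /andP[/eqP-> _]]. Qed.

End LevelStructure.

Theorem proposition6p2 (T : graph) (n : nat) (S : n.-tuple T)
    (hT : tree T) (hS : burning_sequence S) :
  exists D : digraph_structure T,
    induced_by (lambda S) D /\
    @digraph_map (directed D) (path_digraph (end_time S)) (burning_map S).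
Proof.
exists (level_structure (lambda S)); split; first exact: level_structure_induced.
move=> v w vw.
have le_vw := level_dir_le vw; have le_wv := lambda_edge S (level_dir_edge vw).
case: (ltnP (lambda S v) (lambda S w)) => [lt_vw | le_wv'].
  by left; rewrite /= /path_arc /= eqn_leq le_wv.
by right; apply/val_inj/eqP; rewrite /= eqn_leq le_vw.
Qed.
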